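(* Let $S$ be a semigroup, let $T$ be a proper right ideal of $S$, and let $P=P_r(T)$. Then the following conditions are equivalent: (i) $T$ is a right waist. (ii) Either $T=\bigcap_{a\notin T}aP$, or there exists $b\in S-T$ such that $T\subset bS=\bigcap_{a\notin T}aP$ and $T$ is a lower neighbour of $bS$.
   Context: ''Semigroup'' means a (not necessarily commutative) semigroup $S$ with unit element $1$ and zero element $0$, $1\neq 0$. $\subset$ denotes proper inclusion, $S-T$ is set difference, and $aP=\{ap:p\in P\}$; intersections are over $a\in S-T$. A proper right ideal $I$ of $S$ is a right waist if for every right ideal $A$ of $S$, either $A\subseteq I$ or $I\subset A$. For a proper right ideal $A$ of $S$, $P_r(A)=\{s\in S: xs\in A\text{ for some }x\in S-A\}$, called the associated prime right ideal of $A$. ''$T$ is a lower neighbour of $bS$'' means $T\subset bS$ and there is no right ideal $H$ of $S$ with $T\subset H\subset bS$. *)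

(* Defs.v *)
From HB Require Import structures.
From mathcomp Require Import all_boot.
From mathcomp Require Import boolp classical_sets.

Set Implicit Arguments.
Unset Strict Implicit.
Unset Printing Implicit Defensive.

Local Open Scope classical_set_scope.
Local Open Scope group_scope.

(* The semigroups with 1 and 0, 1 != 0, of the source (not necessarily
   commutative) are monoids with a two-sided zero distinct from 1. *)
HB.mixin Record Monoid_hasZero S of Monoid S := {
  zerog : S;
  mul0g : left_zero zerog (@mul S);
  mulg0 : right_zero zerog (@mul S);
  oneg_neq0 : (1 : S) != zerog
}.

#[short(type="monoid0Type")]
HB.structure Definition Monoid0 := {S of Monoid_hasZero S & Monoid S}.

Section Ideals.
Variable S : monoid0Type.
Implicit Types A I T U P : set S.

(* Nonemptiness is the usual convention; it amounts to containing 0. *)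
Definition right_ideal A : Prop :=
  A !=set0 /\ forall a s : S, A a -> A (a * s).

Definition proper_right_ideal A : Prop := right_ideal A /\ A `<` setT.

Definition right_waist I : Prop :=
  proper_right_ideal I /\
  forall A, right_ideal A -> A `<=` I \/ I `<` A.

Definition assoc_prime A : set S :=
  [set s | exists2 x, (~` A) x & A (x * s)].

Definition lmul_set (a : S) P : set S := [set a * p | p in P].

Definition lower_neighbour T U : Prop :=
  T `<` U /\ ~ exists H : set S, [/\ right_ideal H, T `<` H & H `<` U].

End Ideals.

(* Main.v *)
(* Write D for the intersection of the aP, a outside T. If T is a right waist,
   then T is contained in D; and any b in D - T lies in every right ideal
   meeting the complement of T, since such an ideal contains some aP. Hence bS
   is the least right ideal properly containing T, and D, being contained in
   bP, equals bS. Conversely, T contained in D already makes T a right waist: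
   a right ideal containing some a outside T contains aP, hence T. *)
Require Import Defs.
From HB Require Import structures.
From mathcomp Require Import all_boot.
From mathcomp Require Import boolp classical_sets.

Set Implicit Arguments.
Unset Strict Implicit.
Unset Printing Implicit Defensive.

Local Open Scope classical_set_scope.
Local Open Scope group_scope.

Lemma lmul_set_sub_right_ideal (S : monoid0Type) (A P : set S) (a : S) :
  right_ideal A -> A a -> lmul_set a P `<=` A.
Proof. by move=> [_ A_mul] Aa _ [p _ <-]; exact: A_mul. Qed.

(** The [y] that witnesses [p] also witnesses [p * s], as [T] absorbs right factors. *)
Lemma lmul_set_assoc_prime_mulr (S : monoid0Type) (T : set S) (a x s : S) :
  right_ideal T -> lmul_set a (assoc_prime T) x ->
  lmul_set a (assoc_prime T) (x * s).
Proof.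
move=> [_ T_mul] [p [y yT Typ] <-]; exists (p * s); last by rewrite mulgA.
by exists y => //; rewrite mulgA; exact: T_mul.
Qed.

Lemma right_ideal_lmul_setT (S : monoid0Type) (a : S) :
  right_ideal (lmul_set a setT).
Proof.
split; first by exists (a * 1); exists 1.
by move=> _ s [p _ <-]; exists (p * s) => //; rewrite mulgA.
Qed.

Lemma mem_lmul_setT (S : monoid0Type) (a : S) : lmul_set a setT a.
Proof. by exists 1 => //; rewrite mulg1. Qed.

(** The right ideal aS contains [a], so it cannot lie inside [T]. *)
Lemma right_waist_sub_lmul_setT (S : monoid0Type) (T : set S) (a : S) :
  right_waist T -> ~ T a -> T `<` lmul_set a setT.
Proof.
move=> [_ T_waist] aT; case: (T_waist _ (right_ideal_lmul_setT a)) => //.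
by move=> aST; case: aT; exact: aST (mem_lmul_setT a).
Qed.

(** Since [T] lies in aS, each [t] in [T] is some [a * s]; then [a] itself witnesses that [s] is in
    [assoc_prime T]. *)
Lemma right_waist_sub_bigcap (S : monoid0Type) (T : set S) :
  right_waist T -> T `<=` \bigcap_(a in ~` T) lmul_set a (assoc_prime T).
Proof.
move=> T_waist t Tt a aT.
have [s _ ast] := (right_waist_sub_lmul_setT T_waist aT).1 t Tt.
by exists s => //; exists a => //; rewrite ast.
Qed.

Lemma right_waist_of_sub_bigcap (S : monoid0Type) (T P : set S) :
  proper_right_ideal T -> T `<=` \bigcap_(a in ~` T) lmul_set a P ->
  right_waist T.
Proof.
move=> T_proper TD; split=> // A A_ideal.
have [AT|/existsNP[a /not_implyP[Aa aT]]] := pselect (A `<=` T); first by left.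
right; split=> [t Tt|/(_ a Aa)//].
exact: lmul_set_sub_right_ideal A_ideal Aa _ (TD t Tt a aT).
Qed.

Theorem lemma2p13 (S : monoid0Type) (T P : set S)
  (hT : proper_right_ideal T) (hP : P = assoc_prime T) :
  right_waist T <->
  (T = \bigcap_(a in ~` T) lmul_set a P \/
   exists b : S,
     [/\ (~` T) b,
         T `<` lmul_set b setT,
         lmul_set b setT = \bigcap_(a in ~` T) lmul_set a P
       & lower_neighbour T (lmul_set b setT)]).
Proof.
subst P; split; last first.
  case=> [TD|[b [_ [TbS _] bSD _]]];
    apply: (right_waist_of_sub_bigcap (P := assoc_prime T) hT).
    by rewrite -TD.
  by rewrite -bSD; exact: TbS.
move=> T_waist; have TD := right_waist_sub_bigcap T_waist.
set D := \bigcap_(a in _) _ in TD *.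
have [DT|/existsNP[b /not_implyP[Db bT]]] := pselect (D `<=` T).
  by left; apply/seteqP.
right; exists b; have TbS := right_waist_sub_lmul_setT T_waist bT.
split=> //.
  (* [D] absorbs right factors, so it contains bS; conversely [D] lies in bP because [b] is outside
     [T]. *)
  apply/seteqP; split=> [_ [s _ <-] a aT|x /(_ b bT)[p _ <-]]; last by exists p.
  exact: (lmul_set_assoc_prime_mulr s hT.1 (Db a aT)).
split=> // -[H [H_ideal [_ HT] [_ bSH]]].
(* Any [c] in [H] outside [T] puts [b] in cP, hence in [H], so that bS lies in [H]. *)
have /existsNP[c /not_implyP[Hc cT]] := HT.
have Hb : H b := lmul_set_sub_right_ideal H_ideal Hc (Db c cT).
by apply: bSH; exact: lmul_set_sub_right_ideal H_ideal Hb.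
Qed.
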